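(* Let $b\ge2$ be an integer and $\beta>0$. Let $v_0\in\mathcal V$ and suppose that $\theta:=e^{-2\pi^2/\beta}$ obeys $b\theta<1$. Let $\{a_0(n)\}_{n\in\mathbb Z}$ be the positive $\ell^1(\mathbb Z)$-sequence with $e^{-v_0(z)}=\sum_{n\in\mathbb Z}a_0(n)e^{2\pi {\rm i}nz}$, and denote $c_0:=\sup_{n\ge0}\frac{a_0(n+1)}{a_0(n)}$. Let $v_1,v_2,\dots$ be defined recursively from $v_0$ by $e^{-v_{k+1}(z)}:=E\bigl(e^{-bv_k(z+\zeta)}\bigr)$ with $\zeta$ distributed as $\mathcal N(0,1/\beta)$. Then $$\sup_{z,z'\in[0,1]}\bigl|v_{k+1}(z)-bv_k(z')\bigr|\le8(b\theta)^kbc_0$$ holds for all $k\in\mathbb N$ satisfying $(b\theta)^kbc_0\le1/8$.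
   Context: $\mathcal V$ denotes the set of even functions $v\colon\mathbb R\to\mathbb R$ for which there exists a positive sequence $\{a(n)\}_{n\in\mathbb Z}\in\ell^1(\mathbb Z)$ such that $e^{-v(z)}=\sum_{n\in\mathbb Z}a(n)e^{2\pi{\rm i}nz}$ for all $z\in\mathbb R$ and $\sup_{n\ge0}\frac{a(n+1)}{a(n)}<\infty$. *)

(* Defs.v *)
From HB Require Import structures.
From mathcomp Require Import all_boot all_order all_algebra.
From mathcomp Require Import complex.
From mathcomp Require Import all_classical all_reals all_analysis.

Set Implicit Arguments.
Unset Strict Implicit.
Unset Printing Implicit Defensive.

Import Order.TTheory GRing.Theory Num.Theory.
Import numFieldNormedType.Exports.

Local Open Scope classical_set_scope.
Local Open Scope ring_scope.
Local Open Scope complex_scope.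

(* [expi t] is exp(i t), for real t. *)
Definition expi (R : realType) (t : R) : R[i] := cos t +i* sin t.

(* The sum over [-N, N] of a(n) exp(2 pi i n z).  Under the summability
   required in [fourier_expansion], the limit in N is the value of the series
   over Z, for any order of summation. *)
Definition fourier_partial_sum (R : realType) (a : int -> R) (z : R) (N : nat)
    : R[i]^o :=
  \sum_(j < N.*2.+1)
    let n : int := (j : nat)%:Z - N%:Z in
    (a n)%:C * expi (2 * pi * n%:~R * z).

(* [a] is a positive sequence in l^1(Z) whose Fourier series is exp(- v). *)
Definition fourier_expansion (R : realType) (v : R -> R) (a : int -> R) : Prop :=
  [/\ forall n : int, 0 < a n,
      summable [set: int] (fun n : int => (a n)%:E) &
      forall z : R,
        fourier_partial_sum a z N @[N --> \oo] --> ((expR (- v z))%:C : R[i]^o)].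

Definition ratio_sup (R : realType) (a : int -> R) : \bar R :=
  ereal_sup (range (fun n : nat => (a n.+1%:Z / a n%:Z)%:E)).

Definition calV (R : realType) : set (R -> R) :=
  [set v | (forall z : R, v (- z) = v z) /\
           exists a : int -> R,
             fourier_expansion v a /\ (ratio_sup a < +oo)%E].
Arguments calV R : clear implicits.

Definition theta (R : realType) (beta : R) : R := expR (- (2 * pi ^+ 2 / beta)).

(* [zeta] has law N(0, s2), where [s2] is the variance; the second parameter of
   [normal_prob] is the standard deviation.  Laws are compared on measurable
   sets only, since the value of a measure elsewhere is meaningless. *)
Definition centered_normal (R : realType) (d : measure_display)
    (T : measurableType d) (P : probability T R) (zeta : {RV P >-> R})
    (s2 : R) : Prop :=
  forall A : set R, measurable A ->
    distribution P zeta A = normal_prob 0 (Num.sqrt s2) A.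

(* Main.v *)
(* A positive Fourier sequence with ratio bound c is, up to a uniformly small error, a trigonometric
   polynomial with nonnegative even coefficients a(n) such that a(n+1) <= c a(n) for n >= 0.
   Products add the ratio bounds: if n1 + n2 = n + 1 > 0, one of the n_i is positive and can be
   lowered by one.  Gaussian averaging multiplies a(n) by theta^(n^2), hence the ratio bound by
   theta.  So exp(- v_k) has ratio bound (b theta)^k c_0, and both exp(- b v_k) and its average
   exp(- v_{k+1}) have ratio bound r = (b theta)^k b c_0 with the same coefficient h at
   frequency 0.  Since the other coefficients sum to at most 2 r h / (1 - r), the ratio of any
   value of one function to any value of the other is at most (1 + r) / (1 - 3 r), which is at
   most exp(8 r) when r <= 1/8.  Evenness of the coefficients follows from that of v_0 because
   Fourier coefficients are unique. *)

Require Import Defs.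
From HB Require Import structures.
From mathcomp Require Import all_boot all_order all_algebra.
From mathcomp Require Import complex.
From mathcomp Require Import all_classical all_reals all_analysis.
From mathcomp Require Import measurable_realfun zify ring lra.

Set Implicit Arguments.
Unset Strict Implicit.
Unset Printing Implicit Defensive.

Import Order.TTheory GRing.Theory Num.Theory.
Import numFieldNormedType.Exports.

Local Open Scope classical_set_scope.
Local Open Scope ring_scope.

(** * Integration against the normal law and over growing intervals *)

(** The Radon-Nikodym derivative of the normal law and [normal_pdf] have the same integral over
    every measurable set, hence agree almost everywhere. *)
Lemma integral_normal_prob (R : realType) (m s : R) (f : R -> \bar R) (U : set R) :
  measurable U -> (normal_prob m s).-integrable U f ->
  (\int[normal_prob m s]_(x in U) f x =
   \int[lebesgue_measure]_(x in U) (f x * (normal_pdf m s x)%:E))%E.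
Proof.
move=> mU fint; have dom := @normal_prob_dominates R m s.
have mf := measurable_int _ fint.
rewrite -(Radon_Nikodym_change_of_variables dom)//=.
apply: ae_eq_integral => //.
- apply: emeasurable_funM => //; apply: (measurable_int (@lebesgue_measure R)).
  apply: (integrableS _ _ (@subsetT _ _)) => //=.
  exact: Radon_Nikodym_integrable.
- apply: emeasurable_funM => //=; apply/measurable_EFinP.
  by apply/measurable_funTS; exact: measurable_normal_pdf.
- apply: ae_eqe_mul2l => /=.
  rewrite Radon_NikodymE//=.
  case: cid => /= h [h1 h2 h3].
  apply: integral_ae_eq => //=.
  + exact: integrableS h2.
  + by apply/measurable_EFinP/measurable_funTS; exact: measurable_normal_pdf.
  + by move=> E E01 mE; rewrite -h3.
Qed.

Lemma integrable_itv_continuous (R : realType) (f : R -> R) (x y : R) :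
  continuous f -> (@lebesgue_measure R).-integrable `[x, y] (EFin \o f).
Proof.
move=> cf; apply: continuous_compact_integrable; first exact: segment_compact.
exact: continuous_subspaceT.
Qed.

Lemma cvg_Rintegral_itv (R : realType) (f : R -> R) :
  (@lebesgue_measure R).-integrable setT (EFin \o f) ->
  \int[lebesgue_measure]_(x in `[- n%:R, n%:R]) f x @[n --> \oo] -->
  \int[lebesgue_measure]_x f x.
Proof.
move=> intf; have mf := measurable_int _ intf.
pose fn (n : nat) := (EFin \o f) \_ (`[- n%:R, n%:R]%classic : set R).
have [] := @dominated_convergence _ _ _ (@lebesgue_measure R) setT measurableT fn
  (EFin \o f) (fun x => `|f x|%:E).
- move=> n; apply/(measurable_restrictT _ _).1 => //; exact: measurable_funTS.
- exact: mf.
- apply: aeW => x _; apply: cvg_near_cst.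
  exists (Num.truncn `|x|).+1 => // n /= xn; rewrite /fn patchE ifT//.
  rewrite inE/= in_itv/= -ler_norml; apply: ltW; apply: (lt_le_trans (truncnS_gt _)).
  by rewrite ler_nat.
- exact: integrable_norm.
- apply: aeW => x n _; rewrite /fn patchE; case: ifP => _ //=.
  by rewrite normr0 lee_fin.
move=> _ _ H.
have fint : (\int[lebesgue_measure]_x (f x)%:E)%E \is a fin_num by apply: integrable_fin_num.
rewrite -(fineK fint) in H.
move/fine_cvgP: H => [_ H].
apply: cvg_trans H; apply: near_eq_cvg; apply: nearW => n.
by rewrite /Rintegral integral_mkcond.
Qed.

(** * Characteristic function of the centered normal law *)

Section normal_characteristic_function.
Variables (R : realType) (s a : R).
Hypothesis s0 : s != 0.

Local Notation mu := (@lebesgue_measure R).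

(* [u] and [w] have the same mixed derivative [du]: the derivative in [t] of the integral of
   [u t] over [-n, n] is therefore the boundary term [w t n - w t (- n)], which vanishes as [n]
   grows. *)
Let phi (x : R) := expR (- (x ^+ 2 / (s ^+ 2 *+ 2))).
Let u (t x : R) := expR (s ^+ 2 * t ^+ 2 / 2) * (cos (t * x + a) * phi x).
Let w (t x : R) := expR (s ^+ 2 * t ^+ 2 / 2) * (s ^+ 2 * sin (t * x + a) * phi x).
Let du (t x : R) :=
  expR (s ^+ 2 * t ^+ 2 / 2) * ((s ^+ 2 * t * cos (t * x + a) - x * sin (t * x + a)) * phi x).

Let is_derive_u (t x : R) : is_derive t 1 (u ^~ x : R -> R) (du t x).
Proof. by rewrite /u /du; apply: is_derive_eq; rewrite /GRing.scale/=; field. Qed.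

Let is_derive_w (t x : R) : is_derive x 1 (w t : R -> R) (du t x).
Proof. by rewrite /w /du /phi; apply: is_derive_eq; rewrite /GRing.scale/=; field. Qed.

Let continuous_u t : continuous (u t).
Proof.
move=> x; apply: differentiable_continuous; apply/derivable1_diffP.
by rewrite /u /phi; apply: ex_derive.
Qed.

Let continuous_du t : continuous (du t).
Proof.
move=> x; apply: differentiable_continuous; apply/derivable1_diffP.
by rewrite /du /phi; apply: ex_derive.
Qed.

Let phi_le1 x : phi x <= 1.
Proof.
by rewrite -expR0 ler_expR oppr_le0 divr_ge0 ?sqr_ge0 ?mulrn_wge0 ?sqr_ge0.
Qed.

Let h (n t : R) := \int[mu]_(x in `[-n, n]) u t x.

(** A bound that is constant for [x] in a unit neighbourhood of [t] is what domination requires when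
    differentiating under the integral. *)
Let norm_du_le (n t x y : R) : t - 1 < x < t + 1 -> - n <= y <= n ->
  `|du x y| <= expR (s ^+ 2 * (`|t| + 1) ^+ 2 / 2) * (s ^+ 2 * (`|t| + 1) + n).
Proof.
move=> /andP[tx xt] /andP[ny yn].
have hx : `|x| <= `|t| + 1.
  rewrite ler_norml; have := ler_norm t; have := ler_norm (- t); rewrite normrN; lra.
rewrite /du normrM; apply: ler_pM => //.
  rewrite ger0_norm ?expR_ge0// ler_expR ler_pM2r ?invr_gt0//.
  apply: ler_wpM2l; first exact: sqr_ge0.
  by rewrite -(real_normK (num_real x)) lerXn2r// nnegrE addr_ge0.
rewrite normrM (ger0_norm (expR_ge0 _)) -[leRHS]mulr1.
apply: ler_pM; rewrite ?expR_ge0 ?phi_le1//.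
apply: (le_trans (ler_normB _ _)); apply: lerD.
  rewrite normrM normrM (ger0_norm (sqr_ge0 s)) -mulrA.
  apply: ler_wpM2l; first exact: sqr_ge0.
  rewrite -[leRHS]mulr1; apply: ler_pM => //.
  by rewrite ler_norml cos_geN1 cos_le1.
rewrite normrM -[leRHS]mulr1; apply: ler_pM => //.
  by rewrite ler_norml ny yn.
by rewrite ler_norml sin_geN1 sin_le1.
Qed.

(** Differentiation under the integral gives the integral of [du t], and [w t] is a primitive of
    [du t]. *)
Let is_derive_h (n t : R) : 0 < n -> is_derive t 1 (h n) (w t n - w t (- n)).
Proof.
move=> n0.
have It : `]t - 1, t + 1[%classic t by rewrite /= in_itv/=; lra.
pose G := fun _ : R => expR (s ^+ 2 * (`|t| + 1) ^+ 2 / 2) * (s ^+ 2 * (`|t| + 1) + n).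
have G0 y : 0 <= G y.
  apply: mulr_ge0; first exact: expR_ge0.
  by apply: addr_ge0; [rewrite mulr_ge0 ?sqr_ge0 ?addr_ge0|exact: ltW].
have pu x y : partial1of2 u x y = du x y.
  by rewrite partial1of2E; apply: derive_val; exact: is_derive_u.
have intu x : mu.-integrable `[- n, n] (EFin \o u x).
  by apply: integrable_itv_continuous; exact: continuous_u.
have deru (x y : R) : derivable (u ^~ y : R -> R) x 1 by have [] := is_derive_u x y.
have intG : mu.-integrable `[- n, n] (EFin \o G).
  by apply: integrable_itv_continuous => x; exact: cvg_cst.
have Gub (x y : R) : `]t - 1, t + 1[%classic x -> `[- n, n]%classic y ->
    `|partial1of2 u x y| <= G y.
  by rewrite /= !in_itv/= pu => xt yn; exact: norm_du_le.
have mI : measurable (`[- n, n]%classic : set (measurableTypeR R)) by [].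
split.
  exact: (derivable_under_integral mI It
    (fun x _ => intu x) (fun x y _ _ => deru x y) G0 intG Gub).
rewrite -derive1E (differentiation_under_integral mI It
  (fun x _ => intu x) (fun x y _ _ => deru x y) G0 intG Gub).
under eq_Rintegral do rewrite pu.
rewrite /Rintegral (@continuous_FTC2 _ (du t) (w t))//.
- by rewrite lt_neqAle; lra.
- exact/continuous_subspaceT/continuous_du.
- have cw : continuous (w t).
    move=> x; apply: differentiable_continuous; apply/derivable1_diffP.
    by have [] := is_derive_w t x.
  split.
  + by move=> x _; have [] := is_derive_w t x.
  + exact/cvg_at_right_filter/cw.
  + exact/cvg_at_left_filter/cw.
- by move=> x _; rewrite derive1E; apply: derive_val; exact: is_derive_w.
Qed.

Let h_dist_le (n t : R) : 0 < n ->
  `|h n t - h n 0| <= `|t| * (2 * s ^+ 2 * expR (s ^+ 2 * t ^+ 2 / 2) * phi n).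
Proof.
move=> n0.
have wb x : `|x| <= `|t| ->
    `|w x n - w x (- n)| <= 2 * s ^+ 2 * expR (s ^+ 2 * t ^+ 2 / 2) * phi n.
  move=> xt; set E := expR (s ^+ 2 * t ^+ 2 / 2).
  (* The factor 2 is taken out so that the remaining half difference of sines has absolute value at
     most 1. *)
  have -> : w x n - w x (- n) =
      2 * s ^+ 2 * expR (s ^+ 2 * x ^+ 2 / 2) * phi n *
        ((sin (x * n + a) - sin (x * (- n) + a)) / 2).
    by rewrite /w /phi sqrrN; field.
  rewrite normrM -[leRHS]mulr1; apply: ler_pM => //; last first.
    have := sin_geN1 (x * n + a); have := sin_le1 (x * n + a).
    have := sin_geN1 (x * - n + a); have := sin_le1 (x * - n + a).
    by rewrite ler_norml; lra.
  have s2 : 0 <= 2 * s ^+ 2 by rewrite mulr_ge0 ?sqr_ge0.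
  rewrite ger0_norm; last by apply: mulr_ge0; [apply: mulr_ge0|]; rewrite ?expR_ge0.
  apply: ler_wpM2r; first exact: expR_ge0.
  apply: ler_wpM2l; first exact: s2.
  rewrite ler_expR ler_pM2r ?invr_gt0//; apply: ler_wpM2l; first exact: sqr_ge0.
  by rewrite -(real_normK (num_real x)) -(real_normK (num_real t)) lerXn2r// nnegrE.
have ch : continuous (h n).
  move=> x; apply: differentiable_continuous; apply/derivable1_diffP.
  by have [] := is_derive_h x n0.
have [t0|t0] := leP 0 t.
  have [c + ->] := MVT_segment t0 (fun x _ => is_derive_h x n0) (continuous_subspaceT ch).
  rewrite in_itv/= => /andP[c0 ct]; rewrite subr0 normrM mulrC.
  by apply: ler_wpM2l => //; apply: wb; rewrite !ger0_norm.
have [c + E] := MVT_segment (ltW t0) (fun x _ => is_derive_h x n0) (continuous_subspaceT ch).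
rewrite in_itv/= => /andP[c0 ct]; rewrite distrC E sub0r normrM normrN mulrC.
apply: ler_wpM2l => //; apply: wb; rewrite !ler0_norm ?lerN2//; exact: ltW.
Qed.

Let cvg_phi : phi n%:R @[n --> \oo] --> (0 : R).
Proof.
have M0 : 0 < (s ^+ 2 *+ 2)^-1 by rewrite invr_gt0 pmulrn_lgt0// exprn_even_gt0.
have phiy : phi x @[x --> +oo] --> (0 : R).
  apply: (cvg_comp (fun x : R => x ^+ 2 / (s ^+ 2 *+ 2)) (fun x => expR (- x))).
    exact: (gt0_cvgMly M0 (@cvgr_expr2 R)).
  exact: cvgr_expR.
exact: (cvg_comp (fun n : nat => n%:R : R) phi cvgr_idn phiy).
Qed.

(** As [n] grows, [h n t - h n 0] tends to 0 by [h_dist_le], so the integral times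
    [expR (s ^+ 2 * t ^+ 2 / 2)] does not depend on [t]; at [t = 0] it is [cos a]. *)
Lemma integral_cos_normal_prob t :
  (\int[normal_prob 0 s]_x (cos (t * x + a))%:E =
   (expR (- (s ^+ 2 * t ^+ 2 / 2)) * cos a)%:E)%E.
Proof.
have cc : continuous (fun x => cos (t * x + a)).
  by move=> x; apply: differentiable_continuous; apply/derivable1_diffP; exact: ex_derive.
have mc : measurable_fun setT (fun x : R => cos (t * x + a)).
  exact: continuous_measurable_fun.
have cosb x : `|cos (t * x + a)| <= 1 by rewrite ler_norml cos_geN1 cos_le1.
have intP : (normal_prob 0 s).-integrable setT (fun x : R => (cos (t * x + a))%:E).
  apply: measurable_bounded_integrable => //.
  - by rewrite /= /normal_prob integral_normal_pdf ltry.
  - by exists 1; split => // y y1 x _; apply: (le_trans (cosb x)); exact: ltW.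
rewrite integral_normal_prob//.
have pdfE x : normal_pdf 0 s x = normal_peak s * phi x.
  by rewrite /normal_pdf (negbTE s0) /normal_fun subr0 mulNr.
have int0 := @integrable_normal_pdf R 0 s.
pose f (x : R) := cos (t * x + a) * normal_pdf 0 s x.
have intf : mu.-integrable setT (EFin \o f).
  apply: (le_integrable _ _ _ int0) => //.
    by apply/measurable_EFinP; apply: measurable_funM => //; exact: measurable_normal_pdf.
  move=> x _ /=; rewrite lee_fin /f normrM ler_piMl//.
rewrite -[LHS]fineK; last exact: integrable_fin_num.
congr EFin; change (\int[mu]_x f x = expR (- (s ^+ 2 * t ^+ 2 / 2)) * cos a).
have H1 : normal_peak s * h n%:R t @[n --> \oo] -->
    expR (s ^+ 2 * t ^+ 2 / 2) * \int[mu]_x f x.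
  have : expR (s ^+ 2 * t ^+ 2 / 2) * (\int[mu]_(x in `[- n%:R, n%:R]) f x) @[n --> \oo] -->
      expR (s ^+ 2 * t ^+ 2 / 2) * \int[mu]_x f x by apply: cvgMl_tmp; exact: cvg_Rintegral_itv.
  apply: cvg_trans; apply: near_eq_cvg; apply: nearW => n.
  rewrite -RintegralZl//; last exact: integrableS intf.
  rewrite -RintegralZl//; last exact/integrable_itv_continuous/continuous_u.
  by apply: eq_Rintegral => x _; rewrite /f /u pdfE; ring.
have H2 : normal_peak s * h n%:R 0 @[n --> \oo] --> cos a.
  have : cos a * (\int[mu]_(x in `[- n%:R, n%:R]) normal_pdf 0 s x) @[n --> \oo] --> cos a * 1.
    apply: cvgMl_tmp; have := cvg_Rintegral_itv int0.
    by rewrite {2}/Rintegral integral_normal_pdf.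
  rewrite mulr1; apply: cvg_trans; apply: near_eq_cvg; apply: nearW => n.
  rewrite -RintegralZl//; last exact: integrableS int0.
  rewrite -RintegralZl//; last exact/integrable_itv_continuous/continuous_u.
  apply: eq_Rintegral => x _; rewrite pdfE /u mul0r add0r expr0n/= mulr0 mul0r expR0; ring.
have H3 : normal_peak s * h n%:R t - normal_peak s * h n%:R 0 @[n --> \oo] --> (0 : R).
  apply/norm_cvg0P.
  pose C := normal_peak s * (`|t| * (2 * s ^+ 2 * expR (s ^+ 2 * t ^+ 2 / 2))).
  apply: (@squeeze_cvgr _ _ _ _ (fun=> 0) (fun n : nat => C * phi n%:R)).
  - near=> n; rewrite normr_ge0/= -mulrBr normrM ger0_norm ?normal_peak_ge0//.
    have n0 : (0 : R) < n%:R by near: n; exists 1%N => // m /=; rewrite ltr0n.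
    have := ler_wpM2l (normal_peak_ge0 s) (h_dist_le t n0).
    by rewrite /C !mulrA.
  - exact: cvg_cst.
  - by rewrite -[X in _ --> X](mulr0 C); apply: cvgMl_tmp; exact: cvg_phi.
have E : expR (s ^+ 2 * t ^+ 2 / 2) * \int[mu]_x f x - cos a = 0.
  rewrite -(cvg_lim (@norm_hausdorff _ _) H3); apply/esym/cvg_lim => //.
  exact: cvgB H1 H2.
apply: (mulfI (lt0r_neq0 (expR_gt0 (s ^+ 2 * t ^+ 2 / 2)))).
by rewrite [RHS]mulrA expRxMexpNx_1 mul1r; apply/eqP; rewrite -subr_eq0 E.
Unshelve. all: by end_near.
Qed.

End normal_characteristic_function.

(** * Trigonometric polynomials with even nonnegative coefficients *)

Section trigonometric_polynomials.
Variable R : realType.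
Local Open Scope complex_scope.
Implicit Types (p q : {poly R}) (M N : nat) (c r t x y z : R).

Lemma expi0 : expi (0 : R) = 1.
Proof. by rewrite /expi cos0 sin0. Qed.

Lemma expiD x y : expi (x + y) = expi x * expi y.
Proof. by rewrite /expi cosD sinD; simpc; rewrite (addrC (cos x * sin y)). Qed.

Lemma expiMn x n : expi (n%:R * x) = expi x ^+ n.
Proof.
elim: n => [|n IHn]; first by rewrite mul0r expi0.
by rewrite -natr1 mulrDl mul1r expiD IHn exprSr.
Qed.

Lemma norm_expi x : `|expi x| = 1.
Proof. by rewrite normc_def /= cos2Dsin2 sqrtr1. Qed.

(* A trigonometric polynomial of degree at most [M] is encoded by an ordinary polynomial [p]:
   its coefficient at frequency [n] is [p`_(M + n)]. *)
Definition cospoly M p z : R :=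
  \sum_(j < M.*2.+1) p`_j * cos (2 * pi * (j%:R - M%:R) * z).

Definition exppoly M p z : R[i] :=
  \sum_(j < M.*2.+1) (p`_j)%:C * expi (2 * pi * (j%:R - M%:R) * z).

Definition admissible M c p :=
  [/\ (size p <= M.*2.+1)%N, forall j, 0 <= p`_j,
      forall j, (j <= M.*2)%N -> p`_(M.*2 - j) = p`_j
    & forall j, (M <= j)%N -> p`_j.+1 <= c * p`_j].

(** Factoring out the lowest frequency leaves an ordinary polynomial at a point of the unit circle,
    so polynomial products encode products of trigonometric polynomials. *)
Lemma exppolyE M p z : (size p <= M.*2.+1)%N ->
  exppoly M p z = expi (- (M%:R * (2 * pi * z))) *
    (map_poly (real_complex R) p).[expi (2 * pi * z)].
Proof.
move=> sp; rewrite (@horner_coef_wide _ M.*2.+1); last by rewrite size_map_poly.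
rewrite mulr_sumr; apply: eq_bigr => j _.
rewrite coef_map/= mulrCA -expiMn -expiD; congr (_ * expi _); ring.
Qed.

Lemma exppolyM M N p q z : (size p <= M.*2.+1)%N -> (size q <= N.*2.+1)%N ->
  exppoly (M + N) (p * q) z = exppoly M p z * exppoly N q z.
Proof.
move=> sp sq; rewrite !exppolyE//; last first.
  by apply: (leq_trans (size_polyMleq _ _)); rewrite doubleD; lia.
rewrite rmorphM hornerM/= mulrACA -expiD; congr (expi _ * _); rewrite natrD; ring.
Qed.

Lemma Re_exppoly M p z : complex.Re (exppoly M p z) = cospoly M p z.
Proof.
rewrite /exppoly /cospoly (raddf_sum (@complex.Re R : Rcomplex R -> R)).
by apply: eq_bigr => j _; rewrite /expi; simpc.
Qed.

(** The reversal [j -> 2M - j] exchanges opposite frequencies, so the imaginary part equals its own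
    opposite. *)
Lemma exppoly_real M c p z : admissible M c p -> exppoly M p z = (cospoly M p z)%:C.
Proof.
move=> [_ _ sym _]; rewrite -Re_exppoly; apply/eqP; rewrite eq_complex/= eqxx/=.
rewrite (raddf_sum (@complex.Im R : Rcomplex R -> R)).
set S := (X in X == 0).
suff SN : S = - S by apply/eqP; move: SN; lra.
rewrite {1}/S (reindex_inj rev_ord_inj)/= -sumrN; apply: eq_bigr => j _.
rewrite subSS sym; last by rewrite -ltnS.
have E (i : nat) : (i <= M.*2)%N -> (M.*2 - i)%:R = 2 * M%:R - i%:R :> R.
  by move=> iM; rewrite natrB// -mul2n natrM.
rewrite E; last by rewrite -ltnS.
rewrite /expi; simpc; rewrite -mulrN -sinN; congr (_ * sin _); ring.
Qed.

(** In this form both indices range over full windows, and the symmetry of a product follows by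
    reversing each of them. *)
Lemma coefM_wide M N p q k :
  (size p <= M.*2.+1)%N -> (size q <= N.*2.+1)%N ->
  (p * q)`_k = \sum_(i < M.*2.+1) \sum_(j < N.*2.+1) p`_i * q`_j * ((i + j)%N == k)%:R.
Proof.
move=> sp sq.
have wide L (s : {poly R}) : (size s <= L.*2.+1)%N -> s = \poly_(i < L.*2.+1) s`_i.
  move=> sL; apply/polyP => i; rewrite coef_poly; case: ltnP => // Li.
  by rewrite nth_default// (leq_trans sL).
rewrite {1}(wide _ _ sp) {1}(wide _ _ sq) !poly_def mulr_suml coef_sum; apply: eq_bigr => i _.
rewrite mulr_sumr coef_sum; apply: eq_bigr => j _.
by rewrite -scalerAl -scalerAr -exprD scalerA coefZ coefXn eq_sym.
Qed.

Lemma admissibleM M N c d p q : 0 <= c -> 0 <= d ->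
  admissible M c p -> admissible N d q -> admissible (M + N) (c + d) (p * q).
Proof.
move=> c0 d0 [sp p0 symp rp] [sq q0 symq rq]; split.
- by apply: (leq_trans (size_polyMleq _ _)); rewrite doubleD; lia.
- by move=> j; rewrite coefM sumr_ge0// => i _; rewrite mulr_ge0.
- move=> k kMN; rewrite !(coefM_wide _ sp sq).
  rewrite (reindex_inj rev_ord_inj)/=; apply: eq_bigr => i _.
  rewrite (reindex_inj rev_ord_inj)/=; apply: eq_bigr => j _.
  rewrite !subSS symp; last by rewrite -ltnS.
  rewrite symq; last by rewrite -ltnS.
  congr (_ * _%:R); congr nat_of_bool; apply/eqP/eqP;
    by have := ltn_ord i; have := ltn_ord j; move: kMN; rewrite -!addnn; lia.
(* In p_i q_(k+1-i), lower the index of q if i <= M and that of p otherwise. *)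
move=> k kMN; rewrite !coefM mulrDl addrC.
rewrite -(big_mkord xpredT (fun i => p`_i * q`_(k.+1 - i))).
rewrite -(big_mkord xpredT (fun i => p`_i * q`_(k - i))).
have pq0 (i : nat) : 0 <= p`_i * q`_(k - i) by rewrite mulr_ge0.
have Mk : (M <= k)%N by apply: leq_trans kMN; rewrite leq_addr.
rewrite (@big_cat_nat _ _ _ M.+1)//=; last by rewrite ltnS (leq_trans Mk).
apply: lerD.
  (* Here [i <= M] and [M + N <= k], hence [N <= k - i] and the ratio bound of [q] applies at
     [k - i]. *)
  apply: (@le_trans _ _ (d * \sum_(0 <= i < M.+1) p`_i * q`_(k - i))).
    rewrite mulr_sumr; apply: ler_sum_nat => i /andP[_ iM].
    by rewrite mulrCA; apply: ler_wpM2l => //; rewrite subSn ?rq//; lia.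
  apply: ler_wpM2l => //; rewrite [leRHS](@big_cat_nat _ _ _ M.+1)//= ?lerDl.
  by rewrite sumr_ge0.
(* After the shift by one the index satisfies [M <= i], where the ratio bound of [p] applies. *)
rewrite big_add1/=; apply: (@le_trans _ _ (c * \sum_(M <= i < k.+1) p`_i * q`_(k - i))).
  rewrite mulr_sumr; apply: ler_sum_nat => i /andP[Mi _].
  by rewrite mulrA subSS ler_wpM2r// rp.
apply: ler_wpM2l => //; rewrite [leRHS](@big_cat_nat _ _ _ M)//=; last exact: leqW.
by rewrite lerDr sumr_ge0.
Qed.

Lemma norm_cos_le1 x : `|cos x| <= 1.
Proof. by rewrite ler_norml cos_geN1 cos_le1. Qed.

Lemma cospoly_bound M p z : (forall j, 0 <= p`_j) ->
  `|cospoly M p z| <= \sum_(j < M.*2.+1) p`_j.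
Proof.
move=> p0; apply: (le_trans (ler_norm_sum _ _ _)); apply: ler_sum => j _.
by rewrite normrM (ger0_norm (p0 j)) ler_piMr// norm_cos_le1.
Qed.

Lemma measurable_cospoly M p : measurable_fun setT (cospoly M p).
Proof.
rewrite /cospoly; apply: measurable_sum => j.
apply: continuous_measurable_fun => z.
by apply: differentiable_continuous; apply/derivable1_diffP; exact: ex_derive.
Qed.

Lemma admissible_le M c d p : c <= d -> admissible M c p -> admissible M d p.
Proof.
move=> cd [sp p0 symp rp]; split=> // j Mj.
by apply: (le_trans (rp _ Mj)); rewrite ler_wpM2r.
Qed.

Lemma cospoly_dist_mid M r p z : 0 <= r -> admissible M r p ->
  `|cospoly M p z - p`_M| * (1 - r) <= 2 * r * p`_M.
Proof.
move=> r0 [sp p0 symp rp].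
have ltM : (M < M.*2.+1)%N by rewrite ltnS -addnn leq_addr.
pose oM := Ordinal ltM.
(* The coefficients of positive frequency satisfy S <= r (p_M + S). *)
pose S := \sum_(M.+1 <= j < M.*2.+1) p`_j.
have S0 : 0 <= S by rewrite sumr_ge0.
have tot : \sum_(j < M.*2.+1) p`_j = p`_M + 2 * S.
  rewrite -(big_mkord xpredT (fun j => p`_j)) (@big_cat_nat _ _ _ M)//=; last exact: ltnW.
  rewrite [X in _ + X]big_ltn// -/S.
  suff -> : \sum_(0 <= j < M) p`_j = S by ring.
  rewrite /S big_nat_rev/= add0n -[in RHS](add0n M.+1) big_addn.
  rewrite (_ : M.*2.+1 - M.+1 = M)%N; last by rewrite subSS -addnn addnK.
  apply: eq_big_nat => i /andP[_ iM]; rewrite -symp; last by rewrite -addnn; lia.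
  by congr (p`_ _); rewrite -addnn; lia.
have SS : S <= r * (p`_M + S).
  rewrite {2}/S -(@big_ltn _ _ _ _ _ (fun j => p`_j))// {1}/S big_add1/=.
  have M2 : (M <= M.*2)%N by rewrite -addnn leq_addr.
  rewrite big_nat_recr//= mulrDr -[leLHS]addr0; apply: lerD; last by rewrite mulr_ge0.
  by rewrite mulr_sumr; apply: ler_sum_nat => j /andP[Mj _]; exact: rp.
have d2 : `|cospoly M p z - p`_M| <= 2 * S.
  rewrite /cospoly (bigD1 oM)//= subrr mulr0 mul0r cos0 mulr1 [X in `|X - _|]addrC addrK.
  apply: (le_trans (ler_norm_sum _ _ _)).
  move: tot; rewrite (bigD1 oM)//= => /addrI <-; apply: ler_sum => j _.
  by rewrite normrM (ger0_norm (p0 j)) ler_piMr// norm_cos_le1.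
(* For [r > 1] the left-hand side is nonpositive; otherwise [SS] rearranges to
   [S * (1 - r) <= r * p_M]. *)
have [r1|r1] := leP r 1; last first.
  apply: (@le_trans _ _ 0); last by rewrite !mulr_ge0.
  by apply: mulr_ge0_le0 => //; lra.
apply: (@le_trans _ _ (2 * S * (1 - r))); first by apply: ler_wpM2r => //; lra.
nra.
Qed.

(* Coefficient at frequency [n] multiplied by [t ^+ (n ^ 2)]; one of the two truncated
   subtractions is [0] and the other is the absolute value of [n]. *)
Definition heat t M p : {poly R} :=
  \poly_(j < M.*2.+1) (t ^+ ((j - M + (M - j)) ^ 2)%N * p`_j).

Lemma heat_mid t M p : (heat t M p)`_M = p`_M.
Proof.
by rewrite coef_poly ltnS -addnn leq_addr subnn addn0 exp0n// expr0 mul1r.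
Qed.

(** For [n >= 0], [(n + 1) ^ 2 >= n ^ 2 + 1], so each step away from frequency 0 gains at least one
    factor [t]. *)
Lemma admissible_heat t M c p : 0 <= t <= 1 -> 0 <= c ->
  admissible M c p -> admissible M (t * c) (heat t M p).
Proof.
move=> /andP[t0 t1] c0 [sp p0 symp rp]; split.
- exact: size_poly.
- by move=> j; rewrite coef_poly; case: ifP => // _; rewrite mulr_ge0 ?exprn_ge0.
- move=> j jM; rewrite !coef_poly !ltnS leq_subr jM symp//; congr (_ ^+ (_ ^ 2)%N * _).
  by move: jM; rewrite -addnn; lia.
move=> j Mj; rewrite !coef_poly; case: ifP => [j1|_]; last first.
  by rewrite mulr_ge0//; [rewrite mulr_ge0|case: ifP => // _; rewrite mulr_ge0 ?exprn_ge0].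
rewrite (ltnW j1) mulrACA; apply: ler_pM => //; rewrite ?exprn_ge0//; last exact: rp.
rewrite -exprS; apply: ler_wiXn2l => //.
rewrite (_ : M - j = 0)%N; last by lia.
rewrite (_ : M - j.+1 = 0)%N; last by lia.
by rewrite subSn// !addn0 -!mulnn; nia.
Qed.

End trigonometric_polynomials.

(** * Gaussian averages of trigonometric polynomials *)

Section normal_expectation.
Variables (R : realType) (d : measure_display) (T : measurableType d).
Variable P : probability T R.

Lemma bounded_integrable (f : T -> R) (B : R) : measurable_fun setT f ->
  (forall x, `|f x| <= B) -> P.-integrable setT (EFin \o f).
Proof.
move=> mf fB; apply: measurable_bounded_integrable => //.
  by rewrite /= probability_setT ltry.
by exists B; split; [exact: num_real|move=> y By x _; exact: le_trans (fB x) (ltW By)].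
Qed.

Lemma Rintegral_dist_le (f g : T -> R) (e : R) :
  P.-integrable setT (EFin \o f) -> P.-integrable setT (EFin \o g) ->
  (forall x, `|f x - g x| <= e) -> `|\int[P]_x f x - \int[P]_x g x| <= e.
Proof.
move=> intf intg fg; rewrite -RintegralB//.
have intfg : P.-integrable setT (EFin \o (f \- g)%R).
  by apply: (eq_integrable measurableT _ _ _ (integrableB measurableT intf intg)) => x _.
apply: (le_trans (le_normr_Rintegral _ intfg)) => //.
have -> : e = \int[P]_(x in setT) (cst e) x.
  by rewrite Rintegral_cst//= probability_setT mulr1.
apply: le_Rintegral => //.
- exact: (integrable_norm intfg).
- by apply: (@bounded_integrable _ `|e|) => //; exact: measurable_cst.
- by move=> x _; exact: fg.
Qed.

Variables (zeta : {RV P >-> R}) (s2 : R).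
Hypotheses (s20 : 0 < s2) (hzeta : centered_normal zeta s2).

Lemma measurable_shift (f : R -> R) (z : R) : measurable_fun setT f ->
  measurable_fun setT (fun w => f (z + zeta w)).
Proof.
move=> mf; apply: measurableT_comp => //; exact: measurable_funD.
Qed.

Lemma expectation_cos (t a : R) :
  \int[P]_w cos (t * zeta w + a) = expR (- (s2 * t ^+ 2 / 2)) * cos a.
Proof.
(* [zeta] takes values in [R] with its default measurable structure, whereas [normal_prob] lives
   on [measurableTypeR R]: the measurable sets are the same, but the displays differ. *)
pose f (x : measurableTypeR R) : \bar R := (cos (t * x + a))%:E.
have mc : measurable_fun setT (fun x : R => cos (t * x + a)).
  apply: continuous_measurable_fun => z.
  by apply: differentiable_continuous; apply/derivable1_diffP; exact: ex_derive.
have mf : measurable_fun setT f by apply/measurable_EFinP.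
have mz : measurable_fun setT (zeta : T -> measurableTypeR R).
  by move=> mT Y mY; exact: (measurable_funPT zeta mT Y mY).
have intf : P.-integrable setT (f \o (zeta : T -> measurableTypeR R)).
  apply: (@bounded_integrable (fun w => cos (t * zeta w + a)) 1).
    exact: (measurableT_comp mc).
  by move=> w; rewrite norm_cos_le1.
have s0 : Num.sqrt s2 != 0 by rewrite sqrtr_eq0 -ltNge.
have := @integral_cos_normal_prob _ (Num.sqrt s2) a s0 t; rewrite sqr_sqrtr ?ltW// => E.
rewrite /Rintegral -[RHS]/(fine (expR (- (s2 * t ^+ 2 / 2)) * cos a)%:E) -E; congr fine.
have := @integral_pushforward _ _ _ (measurableTypeR R) R _ mz P setT f mf intf measurableT.
rewrite preimage_setT => <-.
by apply: eq_measure_integral => A mA _; exact: hzeta.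
Qed.

(** Frequency [n] means angular frequency [2 * pi * n], which is damped by [exp(- s2 (2 pi n)^2 / 2)
    = exp(- 2 pi^2 s2 n^2)], that is, by [t ^+ (n ^ 2)]. *)
Lemma expectation_cospoly (t : R) (M : nat) (p : {poly R}) (z : R) :
  (forall j, 0 <= p`_j) ->
  (forall n : nat, t ^+ n = expR (- (2 * pi ^+ 2 * s2 * n%:R))) ->
  \int[P]_w cospoly M p (z + zeta w) = cospoly M (heat t M p) z.
Proof.
move=> p0 tE.
have ic (x a : R) : P.-integrable setT (fun w => (cos (x * zeta w + a))%:E).
  apply: (@bounded_integrable (fun w => cos (x * zeta w + a)) 1) => [|w];
    last exact: norm_cos_le1.
  have mcos : measurable_fun setT (@cos R).
    by apply: continuous_measurable_fun; exact: continuous_cos.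
  apply: (measurableT_comp mcos).
  by apply: measurable_funD => //; exact: measurable_funM.
pose k (j : 'I_M.*2.+1) := 2 * pi * (j%:R - M%:R) : R.
rewrite /Rintegral.
under eq_integral => w _.
  rewrite /cospoly -sumEFin.
  under eq_bigr => j _.
    rewrite (_ : 2 * pi * _ * _ = k j * zeta w + k j * z); last by rewrite /k; ring.
    rewrite EFinM.
    over.
  over.
rewrite integral_sum//; last by move=> j; apply: integrableZl.
have -> : (\sum_(j < M.*2.+1) \int[P]_w ((p`_j)%:E * (cos (k j * zeta w + k j * z))%:E) =
   \sum_(j < M.*2.+1) (p`_j * (expR (- (s2 * k j ^+ 2 / 2)) * cos (k j * z)))%:E)%E.
  apply: eq_bigr => j _; rewrite integralZl// EFinM -expectation_cos fineK//.
  exact: integrable_fin_num.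
rewrite sumEFin/=; apply: eq_bigr => j _.
rewrite coef_poly ltn_ord tE mulrA (mulrC p`_j); congr (expR _ * _ * _).
have -> : ((j - M + (M - j)) ^ 2)%:R = (j%:R - M%:R) ^+ 2 :> R.
  rewrite natrX; have [jM|/ltnW Mj] := leqP j M.
    by rewrite (eqP jM) add0n natrB// -sqrrN opprB.
  by rewrite (eqP Mj) addn0 natrB.
by rewrite /k; field.
Qed.

End normal_expectation.

(** * Uniform limits of admissible polynomials *)

Section approximation.
Variable R : realType.
Local Open Scope complex_scope.
Implicit Types (p q : {poly R}) (M N : nat) (c r x y z e : R) (f g : R -> R).

(** Exact coefficients of products would be convolutions over Z; uniform approximation by finite
    sums keeps products and averages within polynomials, where ratio bounds are algebraic. *)
Definition approximable c f :=
  forall e, 0 < e -> exists M p, admissible M c p /\ forall z, `|f z - cospoly M p z| <= e.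

Lemma approximable_bounded c f : approximable c f ->
  exists2 B, 0 <= B & forall z, `|f z| <= B.
Proof.
move=> /(_ 1 ltr01)[M [p [[_ p0 _ _] fp]]].
exists (1 + \sum_(j < M.*2.+1) p`_j); first by rewrite addr_ge0// sumr_ge0.
move=> z; rewrite -(subrK (cospoly M p z) (f z)).
by rewrite (le_trans (ler_normD _ _))// lerD// cospoly_bound.
Qed.

(** Approximations with error [1 / (n + 1)] exhibit [f] as a pointwise limit of continuous
    functions. *)
Lemma approximable_measurable c f : approximable c f -> measurable_fun setT f.
Proof.
move=> fc.
have H n : {Mp : nat * {poly R} | forall z, `|f z - cospoly Mp.1 Mp.2 z| <= n.+1%:R^-1}.
  apply: cid; have [|M [p [_ fp]]] := fc n.+1%:R^-1; first by rewrite invr_gt0.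
  by exists (M, p).
apply: (@measurable_fun_cvg _ _ _ _ (fun n => cospoly (sval (H n)).1 (sval (H n)).2)).
  by move=> n; exact: measurable_cospoly.
move=> z _; apply/cvgrPdist_le => e e0.
near=> n; apply: (le_trans (svalP (H n) z)).
rewrite -(invrK e) lef_pV2 ?posrE ?invr_gt0//.
apply: ltW; apply: (lt_le_trans (truncnS_gt _)); rewrite ler_nat ltnS.
by near: n; exists (Num.truncn e^-1).
Unshelve. all: by end_near.
Qed.

Lemma approximableM c d f g : 0 <= c -> 0 <= d ->
  approximable c f -> approximable d g -> approximable (c + d) (f \* g).
Proof.
move=> c0 d0 fc gd e e0.
have [B B0 fB] := approximable_bounded fc; have [C C0 gC] := approximable_bounded gd.
(* If both factors are approximated within [e' <= 1], the product is approximated within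
   [B * e' + e' * (C + 1)], where [C + 1] bounds the polynomial close to [g]. *)
pose e' := Num.min 1 (e / (B + C + 1)).
have D0 : 0 < B + C + 1 by rewrite ltr_wpDl// addr_ge0.
have e'0 : 0 < e' by rewrite lt_min ltr01 divr_gt0.
have [M [p [pa fp]]] := fc _ e'0; have [N [q [qa gq]]] := gd _ e'0.
exists (M + N)%N, (p * q); split; first exact: admissibleM.
(* Products of cosine sums are read off from [exppoly], which is multiplicative and real on
   admissible polynomials. *)
move=> z; have -> : cospoly (M + N) (p * q) z = cospoly M p z * cospoly N q z.
  apply: complexI; rewrite rmorphM/= -(exppoly_real _ (admissibleM c0 d0 pa qa)).
  by rewrite -(exppoly_real _ pa) -(exppoly_real _ qa) exppolyM//; [case: pa|case: qa].
have -> : (f \* g) z - cospoly M p z * cospoly N q z =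
   f z * (g z - cospoly N q z) + (f z - cospoly M p z) * (g z - (g z - cospoly N q z)).
  by rewrite /=; ring.
apply: (le_trans (ler_normD _ _)); rewrite !normrM.
have e'1 : e' <= 1 by rewrite ge_min lexx.
have e'e : e' * (B + C + 1) <= e by rewrite -ler_pdivlMr// ge_min lexx orbT.
apply: le_trans e'e; rewrite (_ : e' * _ = B * e' + e' * (C + 1)); last by ring.
apply: lerD; apply: ler_pM => //.
by apply: (le_trans (ler_normB _ _)); apply: lerD => //; exact: le_trans e'1.
Qed.

Lemma approximable1 : approximable 0 (cst 1).
Proof.
move=> e e0; exists 0%N, 1; split.
  split=> [|j|j|j _].
  - by rewrite size_poly1.
  - by rewrite coef1 ler0n.
  - by rewrite double0 leqn0 => /eqP ->.
  - by rewrite coef1 mul0r.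
move=> z; rewrite /cospoly big_ord1 coef1/= subrr mulr0 mul0r cos0 mul1r subrr normr0.
exact: ltW.
Qed.

Lemma approximableX c f n : 0 <= c -> approximable c f ->
  approximable (n%:R * c) (fun z => f z ^+ n).
Proof.
move=> c0 fc; elim: n => [|n IHn].
  rewrite mul0r; have -> : (fun z => f z ^+ 0) = cst 1 by apply/funext => z; rewrite expr0.
  exact: approximable1.
rewrite -natr1 mulrDl mul1r addrC.
have -> : (fun z => f z ^+ n.+1) = f \* (fun z => f z ^+ n).
  by apply/funext => z; rewrite /= exprS.
by apply: approximableM => //; rewrite mulr_ge0.
Qed.

Section smoothing.
Variables (d : measure_display) (T : measurableType d) (P : probability T R).
Variables (zeta : {RV P >-> R}) (s2 t : R).
Hypotheses (s20 : 0 < s2) (hzeta : centered_normal zeta s2).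
Hypothesis tE : forall n : nat, t ^+ n = expR (- (2 * pi ^+ 2 * s2 * n%:R)).
Variables (c : R) (f g : R -> R).
Hypotheses (c0 : 0 <= c) (fc : approximable c f).
Hypothesis fg : forall z, (g z)%:E = ('E_P[(fun w => f (z + zeta w))%R])%E.

(* One polynomial serves for [f] and, after [heat], for its average [g]; hence the same
   coefficient at frequency 0 for both in [smoothing_compare]. *)
Lemma approximable_smooth e : 0 < e -> exists M p, [/\ admissible M c p,
  forall z, `|f z - cospoly M p z| <= e
  & forall z, `|g z - cospoly M (heat t M p) z| <= e].
Proof.
move=> /fc[M [p [pa fp]]]; exists M, p; split=> // z.
have p0 : forall j, 0 <= p`_j by case: pa.
rewrite -(expectation_cospoly s20 hzeta _ _ p0 tE).
have -> : g z = \int[P]_w f (z + zeta w).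
  by have := fg z; rewrite unlock /Rintegral => <-.
have [B B0 fB] := approximable_bounded fc.
apply: Rintegral_dist_le => [||w]; last exact: fp.
  apply: (@bounded_integrable _ _ _ _ (fun w => f (z + zeta w)) B) => [|w]; last exact: fB.
  by apply: measurable_shift; exact: approximable_measurable fc.
apply: (@bounded_integrable _ _ _ _ (fun w => cospoly M p (z + zeta w))
  (\sum_(j < M.*2.+1) p`_j)) => [|w]; last exact: cospoly_bound.
by apply: measurable_shift; exact: measurable_cospoly.
Qed.

Lemma heat_param_bounds : 0 <= t <= 1.
Proof.
have := tE 1; rewrite expr1 => ->; rewrite expR_ge0/= -expR0 ler_expR oppr_le0.
by rewrite !mulr_ge0 ?pi_ge0 ?ltW.
Qed.

Lemma approximable_expectation : approximable (t * c) g.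
Proof.
move=> e /approximable_smooth[M [p [pa _ gp]]]; exists M, (heat t M p); split=> //.
exact: admissible_heat heat_param_bounds c0 pa.
Qed.

(** Up to an arbitrarily small error, [(1 - c) * f z] and [(1 - c) * g z'] both lie between
    [(1 - 3 * c) * h] and [(1 + c) * h], with [h] the common coefficient at frequency 0. Eliminating
    [h] by cross-multiplication avoids dividing by a possibly zero [h]. *)
Lemma smoothing_compare z z' : c <= 1 / 3 ->
  (1 - 3 * c) * f z <= (1 + c) * g z' /\ (1 - 3 * c) * g z' <= (1 + c) * f z.
Proof.
move=> c1.
(* The two approximations cost [(1 - 3 * c) * e + (1 + c) * e], which is at most [4 * e]. *)
have H e : 0 < e -> (1 - 3 * c) * f z - (1 + c) * g z' <= 4 * e /\
    (1 - 3 * c) * g z' - (1 + c) * f z <= 4 * e.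
  move=> e0; have [M [p [pa fp gp]]] := approximable_smooth e0.
  have ha : admissible M c (heat t M p).
    apply: admissible_le (admissible_heat heat_param_bounds c0 pa).
    by rewrite ler_piMl//; case/andP: heat_param_bounds.
  have c1' : 0 < 1 - c by lra.
  have mid q x : admissible M c q ->
      (1 - 3 * c) * q`_M <= (1 - c) * cospoly M q x <= (1 + c) * q`_M.
    move=> /(cospoly_dist_mid x c0).
    by rewrite mulrC -{1}(gtr0_norm c1') -normrM ler_norml; lra.
  have h0 : 0 <= p`_M by case: pa.
  have := mid _ z' ha; have := mid _ z pa.
  rewrite heat_mid; have := fp z; have := gp z'; rewrite !ler_distl.
  set F := cospoly M p z; set G := cospoly _ _ z'; set h := p`_M in h0 *.
  move=> /andP[g1 g2] /andP[f1 f2] /andP[F1 F2] /andP[G1 G2].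
  have c3 : 0 <= 1 - 3 * c by lra.
  have cp : 0 <= 1 + c by rewrite addr_ge0.
  have FG x y : (1 - c) * x <= (1 + c) * h -> (1 - 3 * c) * h <= (1 - c) * y ->
      (1 - 3 * c) * x <= (1 + c) * y.
    move=> X Y; rewrite -(ler_pM2l c1').
    have := ler_wpM2l c3 X; have := ler_wpM2l cp Y; lra.
  have := FG _ _ F2 G1; have := FG _ _ G2 F1.
  have := ler_wpM2l c3 f2; have := ler_wpM2l cp g1.
  have := ler_wpM2l cp f1; have := ler_wpM2l c3 g2.
  have : c * e >= 0 by rewrite mulr_ge0// ltW.
  split; lra.
have e4 e : e = 4 * (e / 4) by field.
split; rewrite -subr_le0; apply/ler_addgt0Pr => e e0; rewrite add0r [leRHS]e4.
  by have [] := H (e / 4) (divr_gt0 e0 (ltr0n _ 4)).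
by have [] := H (e / 4) (divr_gt0 e0 (ltr0n _ 4)).
Qed.
End smoothing.
End approximation.

(** * Fourier series: uniform convergence and uniqueness of coefficients *)

Lemma sum_sym_recr (V : nmodType) (F : int -> V) K :
  \sum_(j < K.+1.*2.+1) F (j%:Z - K.+1%:Z) =
  F (- K.+1%:Z) + \sum_(j < K.*2.+1) F (j%:Z - K%:Z) + F K.+1%:Z.
Proof.
rewrite doubleS big_ord_recr big_ord_recl/= sub0r; congr (_ + _ + F _); last by lia.
by apply: eq_bigr => j _; congr F; rewrite /bump/=; lia.
Qed.

Section fourier.
Variable R : realType.
Local Open Scope complex_scope.
Implicit Types (x e : R) (N m : nat) (f v : R -> R) (a : int -> R) (K : nat) (z c : R).

Lemma expi_2pi : expi (2 * pi : R) = 1.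
Proof. by rewrite /expi mulr_natl cos2pi sin2pi. Qed.

(** With [x = pi * i / N], the value 1 would force [cos (2 x) = 1], hence [sin x = 0]; but [x] lies
    strictly between 0 and [2 pi] and differs from [pi]. *)
Lemma expi_neq1 N i : (0 < i < N.*2)%N -> i != N ->
  expi (i%:R * (2 * pi / N%:R)) != 1 :> R[i].
Proof.
move=> /andP[i0 iN] iNN; have N0 : (0 : R) < N%:R by rewrite ltr0n; lia.
pose x : R := pi * (i%:R / N%:R).
have sx : sin x != 0.
  have xpos : 0 < x by rewrite mulr_gt0 ?pi_gt0// divr_gt0// ltr0n.
  have [ltiN|leNi] := ltnP i N.
    apply: lt0r_neq0; apply: sin_gt0_pi.
    by rewrite xpos -[ltRHS]mulr1 ltr_pM2l ?pi_gt0// ltr_pdivrMr// mul1r ltr_nat.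
  have Ni : (N < i)%N by rewrite ltn_neqAle eq_sym iNN.
  have -> : x = (x - pi) + pi by rewrite subrK.
  rewrite sinDpi oppr_eq0; apply: lt0r_neq0; apply: sin_gt0_pi.
  have -> : x - pi = pi * (i%:R / N%:R - 1) by rewrite /x; ring.
  rewrite mulr_gt0 ?pi_gt0//=; last by rewrite subr_gt0 ltr_pdivlMr// mul1r ltr_nat.
  rewrite -[ltRHS]mulr1 ltr_pM2l ?pi_gt0// ltrBlDr ltr_pdivrMr//.
  by rewrite (_ : (1 + 1) * N%:R = N.*2%:R) ?ltr_nat// -mul2n natrM.
apply: contra sx; rewrite eq_complex/= => /andP[+ _].
have -> : i%:R * (2 * pi / N%:R) = x *+ 2.
  by rewrite /x -mulr_natr; field; exact: lt0r_neq0.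
rewrite cos_mulr2n cos2sin2 => /eqP E; rewrite -sqrf_eq0; apply/eqP; move: E; lra.
Qed.

(** A geometric sum over roots of unity. The range up to [2 N] covers the exponents [j + (N - m)]
    with [j, m < N] that arise in coefficient extraction. *)
Lemma sum_expi N i : (0 < i < N.*2)%N ->
  \sum_(l < N) expi (i%:R * (2 * pi / N%:R)) ^+ l = N%:R *+ (i == N) :> R[i].
Proof.
move=> iN; have N0 : N%:R != 0 :> R by rewrite pnatr_eq0; lia.
have EN : expi (i%:R * (2 * pi / N%:R)) ^+ N = 1 :> R[i].
  rewrite -expiMn mulrCA (_ : N%:R * _ = 2 * pi); last by field.
  by rewrite expiMn expi_2pi expr1n.
have [iE|iNN] := eqVneq i N.
  rewrite iE (_ : N%:R * _ = 2 * pi); last by field.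
  rewrite expi_2pi; under eq_bigr do rewrite expr1n.
  by rewrite sumr_const card_ord.
have := subrX1 (expi (i%:R * (2 * pi / N%:R)) : R[i]) N.
rewrite EN subrr mulr0n => /esym/eqP.
by rewrite mulf_eq0 subr_eq0 (negbTE (expi_neq1 iN iNN))/= => /eqP.
Qed.

Lemma coef_le_unit_circle (q : {poly R[i]}) N m e : (size q <= N)%N -> (m < N)%N ->
  (forall x : R, `|q.[expi x]| <= e%:C) -> `|q`_m| <= e%:C.
Proof.
move=> sq mN qe.
(* Extract the coefficient by averaging over the N-th roots of unity. *)
pose W l : R[i] := expi (l%:R * (2 * pi / N%:R)).
have N0 : (0 : R[i]) < N%:R by rewrite ltr0n; lia.
(* Since [W l] is an [N]-th root of unity, [W l ^+ (N - m)] stands for the negative power that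
   isolates the coefficient of index [m]. *)
have E : \sum_(l < N) q.[W l] * W l ^+ (N - m) = N%:R * q`_m.
  under eq_bigr => l _.
    rewrite (horner_coef_wide _ sq) mulr_suml.
    under eq_bigr => j _.
      rewrite -mulrA -exprD /W expiMn exprAC.
      over.
    over.
  rewrite exchange_big/=.
  have inner (j : 'I_N) :
      \sum_(l < N) q`_j * expi (2 * pi / N%:R) ^+ (j + (N - m)) ^+ l =
      q`_j * (N%:R *+ (j + (N - m) == N)%N).
    rewrite -sum_expi; last by have := ltn_ord j; lia.
    by rewrite mulr_sumr; apply: eq_bigr => l _; rewrite expiMn.
  transitivity (\sum_(j < N) q`_j * (N%:R *+ (j + (N - m) == N)%N)).
    by apply: eq_bigr => j _; exact: inner.
  rewrite (bigD1 (Ordinal mN))//= subnKC ?(ltnW mN)// eqxx mulr1n mulrC.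
  rewrite big1 ?addr0// => j jm; rewrite (_ : (_ == N) = false) ?mulr0n ?mulr0//.
  by apply/negbTE/eqP => E; move/eqP: jm; apply; apply: val_inj => /=; lia.
rewrite -(ler_pM2l N0) -[X in X * `|_|](gtr0_norm N0) -normrM -E.
apply: (le_trans (ler_norm_sum _ _ _)).
apply: (@le_trans _ _ (\sum_(l < N) e%:C)).
  by apply: ler_sum => l _; rewrite normrM normrX norm_expi expr1n mulr1; exact: qe.
by rewrite sumr_const card_ord mulr_natl.
Qed.

Definition window a K : {poly R} := \poly_(j < K.*2.+1) a (j%:Z - K%:Z).

Lemma exppoly_window a K z :
  exppoly K (window a K) z = fourier_partial_sum a z K.
Proof.
apply: eq_bigr => j _; rewrite coef_poly ltn_ord; congr (_ * expi (_ * _ * _)).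
by rewrite rmorphB.
Qed.

Definition uniform_fourier f a := forall e, 0 < e ->
  exists K0, forall K z, (K0 <= K)%N -> `|(f z)%:C - exppoly K (window a K) z| <= e%:C.

Let mass a K := \sum_(j < K.*2.+1) a (j%:Z - K%:Z).

Let mass_bounded a : (forall n, 0 <= a n) ->
  summable [set: int] (fun n => (a n)%:E) -> exists S, forall K, mass a K <= S.
Proof.
move=> a0 sa; exists (fine (\esum_(n in [set: int]) (a n)%:E)) => K.
have sE : \esum_(n in [set: int]) `|(a n)%:E|%E = \esum_(n in [set: int]) (a n)%:E.
  by apply: eq_esum => n _; rewrite gee0_abs// lee_fin.
have fE : (\esum_(n in [set: int]) (a n)%:E)%E \is a fin_num.
  by rewrite -sE -summableE.
rewrite -lee_fin fineK//; apply: esum_ge.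
pose r := [seq j%:Z - K%:Z | j <- iota 0 K.*2.+1].
have ur : uniq r by rewrite map_inj_uniq ?iota_uniq// => i j; lia.
exists [set` r]; first by split => //; exact: finite_seq.
rewrite -fsbig_seq// big_map -/(index_iota 0 K.*2.+1) big_mkord sumEFin.
exact: lexx.
Qed.

(** The masses increase to their supremum, which bounds [mass a K'] for every [K']. *)
Let mass_tail a : (forall n, 0 <= a n) ->
  summable [set: int] (fun n => (a n)%:E) ->
  forall e, 0 < e -> exists K0, forall K K', (K0 <= K)%N -> mass a K' - mass a K <= e.
Proof.
move=> a0 /(mass_bounded a0)[S mS] e e0.
have nd : nondecreasing_seq (mass a).
  by apply/nondecreasing_seqP => n; rewrite /mass sum_sym_recr -addrA addrCA lerDl addr_ge0.
have ub : has_ubound (range (mass a)) by exists S => _ [K _ <-].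
have cv := nondecreasing_cvgn nd ub.
move/cvgrPdist_le : (cv) => /(_ _ e0)[K0 _ HK]; exists K0 => K K' KK.
have := HK K KK; rewrite /= ler_distlC => /andP[+ _].
have : mass a K' <= sup (range (mass a)) by apply: ub_le_sup => //; exists K'.
lra.
Qed.

(** Enlarging the window by one adds two terms, whose moduli are exactly the added mass. *)
Let exppoly_window_dist a K K' z : (forall n, 0 <= a n) -> (K <= K')%N ->
  `|exppoly K' (window a K') z - exppoly K (window a K) z| <= (mass a K' - mass a K)%:C.
Proof.
move=> a0 /subnKC <-; elim: (K' - K)%N => [|n IHn]; first by rewrite addn0 !subrr normr0.
rewrite addnS.
pose F (n : int) : R[i] := (a n)%:C * expi (2 * pi * n%:~R * z).
have EF k : exppoly k (window a k) z = \sum_(j < k.*2.+1) F (j%:Z - k%:Z).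
  by rewrite exppoly_window.
have nF (i : int) : `|F i| = (a i)%:C.
  by rewrite normrM norm_expi mulr1 ger0_norm// ler0c.
move: IHn; rewrite !EF sum_sym_recr /mass sum_sym_recr.
set k := (K + n)%N; set A := \sum_(j < k.*2.+1) _; set B := \sum_(j < _) _.
set sA := \sum_(j < _) _; set sB := \sum_(j < _) _ => IHn.
rewrite (_ : _ - B = (A - B) + (F (- k.+1%:Z) + F k.+1%:Z)); last by ring.
rewrite (_ : _ - sB = (sA - sB) + (a (- k.+1%:Z) + a k.+1%:Z)); last by ring.
apply: (le_trans (ler_normD _ _)); rewrite rmorphD/=; apply: lerD => //.
by apply: (le_trans (ler_normD _ _)); rewrite !nF rmorphD.
Qed.

(** The limit is compared with a partial sum of order [maxn N K]. Only [N] depends on [z]; the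
    distance from that sum to the one of order [K] is at most a tail of the mass, which is uniform
    in [z]. *)
Lemma fourier_expansion_uniform v a : fourier_expansion v a ->
  uniform_fourier (fun z => expR (- v z)) a.
Proof.
move=> [apos sa cva] e e0; have a0 n : 0 <= a n by exact: ltW.
have [K0 HK] := mass_tail a0 sa e0; exists K0 => K z KK.
have cvz := cva z.
apply/ler_addgt0Pr => /= e' e'0.
have /cvgrPdist_le/(_ e' e'0)[N _ HN] := cvz.
have := HN (maxn N K) (leq_maxl _ _); rewrite -exppoly_window => H1.
have H2 := exppoly_window_dist z a0 (leq_maxr N K).
rewrite -(subrK (exppoly (maxn N K) (window a (maxn N K)) z) (expR (- v z))%:C) -addrA addrC.
apply: (le_trans (ler_normD _ _)); apply: lerD => //.
by apply: (le_trans H2); rewrite lecR HK.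
Qed.

Lemma uniform_fourier_unique f a a' :
  uniform_fourier f a -> uniform_fourier f a' -> a =1 a'.
Proof.
move=> fa fa' n; apply/eqP; rewrite -subr_eq0 -normr_le0; apply/ler_addgt0Pr => e e0.
rewrite add0r; have e2 : 0 < e / 2 by rewrite divr_gt0.
have [K0 H0] := fa _ e2; have [K1 H1] := fa' _ e2.
(* Large enough for both approximations and for frequency [n] to lie in the window. *)
pose K := maxn (maxn K0 K1) (absz n).
pose q := map_poly (real_complex R) (window a K - window a' K).
have sq : (size q <= K.*2.+1)%N.
  rewrite size_map_poly (leq_trans (size_polyD _ _))// size_polyN geq_max.
  by rewrite !size_poly.
have m : {m : nat | (m < K.*2.+1)%N /\ m%:Z - K%:Z = n}.
  exists (absz (n + K%:Z)); rewrite /K; lia.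
have [{}m [mK mn]] := m.
have := coef_le_unit_circle (e := e) sq mK.
rewrite coef_map/= coefB !coef_poly mK mn => H.
rewrite -lecR; apply: le_trans (H _); first by rewrite normc_def/= expr0n addr0 sqrtr_sqr.
(* On the unit circle the ordinary polynomial and [exppoly] differ by a factor of modulus 1. *)
move=> x; pose z := x / (2 * pi).
have xz : 2 * pi * z = x by rewrite /z mulrCA mulfV ?mulr1// mulf_neq0// gt_eqF ?pi_gt0.
have E b : (map_poly (real_complex R) (window b K)).[expi x] =
    expi (K%:R * x) * exppoly K (window b K) z.
  by rewrite exppolyE ?size_poly// xz mulrA -expiD subrr expi0 mul1r.
rewrite /q rmorphB hornerD hornerN !E -mulrBr normrM norm_expi mul1r.
rewrite -(subrK (f z)%:C (exppoly K (window a K) z)) -addrA.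
apply: (le_trans (ler_normD _ _)); rewrite (splitr e) rmorphD; apply: lerD.
  by rewrite distrC; apply: H0; rewrite /K; lia.
by apply: H1; rewrite /K; lia.
Qed.

Lemma uniform_fourierN f a : uniform_fourier f a ->
  uniform_fourier (fun z => f (- z)) (fun n => a (- n)).
Proof.
move=> fa e e0; have [K0 H] := fa _ e0; exists K0 => K z /(H K (- z)); congr (`|_ - _| <= _).
rewrite !exppoly_window /fourier_partial_sum (reindex_inj rev_ord_inj)/=.
apply: eq_bigr => j _; have -> : (K.*2.+1 - j.+1)%N%:Z - K%:Z = - (j%:Z - K%:Z).
  by have := ltn_ord j; lia.
by congr (_ * expi _); rewrite rmorphN; ring.
Qed.

Lemma uniform_fourier_approximable f a c : 0 <= c -> (forall n, 0 <= a n) ->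
  (forall n, a (- n) = a n) -> (forall n : nat, a n.+1%:Z <= c * a n%:Z) ->
  uniform_fourier f a -> approximable c f.
Proof.
move=> c0 a0 asym arat fa e e0; have [K H] := fa _ e0.
have aK : admissible K c (window a K).
  split=> [|j|j jK|j Kj]; rewrite ?size_poly// !coef_poly.
  - by case: ifP.
  - by rewrite !ltnS leq_subr jK -asym; congr a; lia.
  - case: ifP => [jK|_]; last by case: ifP => // _; rewrite ?mulr0 ?mulr_ge0.
    by rewrite (ltnW jK); have := arat (j - K)%N; congr (a _ <= c * a _); lia.
exists K, (window a K); split => // z.
have := H K z (leqnn K).
by rewrite (exppoly_real _ aK) -rmorphB normc_def/= expr0n addr0 sqrtr_sqr lecR.
Qed.

End fourier.

(** * From ratio bounds to the estimate on the potentials *)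

Lemma ln_ratio_le (R : realType) (r A B : R) : 0 <= r <= 1 / 8 ->
  (1 - 3 * r) * expR (- B) <= (1 + r) * expR (- A) -> A - B <= 8 * r.
Proof.
move=> /andP[r0 r8] H; rewrite -ler_expR.
have r3 : 0 < 1 - 3 * r by lra.
rewrite -(ler_pM2l r3); apply: (@le_trans _ _ (1 + r)).
  have := ler_wpM2r (expR_ge0 A) H.
  by rewrite -!mulrA -!expRD addNr expR0 mulr1 (addrC (- B)).
(* The product is [1 + 5 r - 24 r^2], at least [1 + r] because [r <= 1/6]; then
   [1 + 8 r <= exp(8 r)]. *)
apply: (@le_trans _ _ ((1 - 3 * r) * (1 + 8 * r))); first by nra.
by rewrite ler_pM2l// expR_ge1Dx.
Qed.

Lemma ratio_le_fine (R : realType) (a : int -> R) (n : nat) : (forall n, 0 < a n) ->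
  (ratio_sup a < +oo)%E -> a n.+1%:Z <= fine (ratio_sup a) * a n%:Z.
Proof.
move=> a0 fin.
have ub (m : nat) : ((a m.+1%:Z / a m%:Z)%:E <= ratio_sup a)%E.
  by apply: ereal_sup_ubound; exists m.
rewrite -ler_pdivrMr// -lee_fin fineK//.
(* [fine] sends infinite values to 0, so [-oo] must be excluded too; the ratio at index 0 does
   it. *)
rewrite fin_numE (lt_eqF fin) andbT gt_eqF//.
by apply: lt_le_trans (ub 0%N); exact: ltNyr.
Qed.

Theorem theorem3p4 (R : realType) (b : nat) (beta : R)
  (hb : (2 <= b)%N) (hbeta : 0 < beta)
  (v : nat -> R -> R) (hv0 : calV R (v 0%N))
  (hbtheta : b%:R * theta beta < 1)
  (a0 : int -> R) (ha0 : fourier_expansion (v 0%N) a0)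
  (c0 : R) (hc0 : c0 = fine (ratio_sup a0))
  (d : measure_display) (T : measurableType d) (P : probability T R)
  (zeta : {RV P >-> R}) (hzeta : centered_normal zeta beta^-1)
  (hrec : forall (k : nat) (z : R),
    (expR (- v k.+1 z))%:E =
      ('E_P[(fun w : T => expR (- (b%:R * v k (z + zeta w))))%R])%E) :
  forall k : nat,
    (b%:R * theta beta) ^+ k * b%:R * c0 <= 1 / 8 ->
    (ereal_sup ([set (`|v k.+1 z - b%:R * v k z'|)%:E
                 | z in `[0, 1] & z' in `[0, 1]])%R
      <= (8 * (b%:R * theta beta) ^+ k * b%:R * c0)%:E)%E.
Proof.
have [v0even [a [fa rfin]]] := hv0.
have ua := fourier_expansion_uniform fa; have ua0 := fourier_expansion_uniform ha0.
(* [calV] provides some expansion with a finite ratio bound; uniqueness of coefficients transfers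
   finiteness to the given [a0]. *)
have aE : a = a0 by apply/funext; exact: uniform_fourier_unique ua ua0.
rewrite aE in rfin; have [a0pos _ _] := ha0.
have a0ge n : 0 <= a0 n by exact: ltW.
have arat (n : nat) : a0 n.+1%:Z <= c0 * a0 n%:Z by rewrite hc0; exact: ratio_le_fine.
have c00 : 0 <= c0.
  by rewrite -(pmulr_lge0 _ (a0pos 0)); apply: le_trans (arat 0%N).
have asym n : a0 (- n) = a0 n.
  have ua0N := uniform_fourierN ua0.
  have v0E : (fun z => expR (- v 0%N (- z))) = (fun z => expR (- v 0%N z)).
    by apply/funext => z; rewrite v0even.
  by rewrite v0E in ua0N; exact: (uniform_fourier_unique ua0N ua0).
have app0 := uniform_fourier_approximable c00 a0ge asym arat ua0.
set q := b%:R * theta beta.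
(* For variance [1 / beta], the damping factor [exp(- 2 pi^2 s2)] is [theta beta]. *)
have tE (n : nat) : theta beta ^+ n = expR (- (2 * pi ^+ 2 * beta^-1 * n%:R)).
  by rewrite /theta -expRM_natl mulrN mulrC.
have s20 : 0 < beta^-1 by rewrite invr_gt0.
have q0 : 0 <= q by rewrite mulr_ge0 ?expR_ge0.
have powE k z : expR (- v k z) ^+ b = expR (- (b%:R * v k z)).
  by rewrite -expRM_natl mulrN.
have rec k z : (expR (- v k.+1 z))%:E =
    ('E_P[(fun w => expR (- v k (z + zeta w)) ^+ b)%R])%E.
  by rewrite hrec; congr ('E_P[_]%E); apply/funext => w; rewrite powE.
(* Each step takes a [b]-th power, which multiplies the bound by [b], and then an average, which
   multiplies it by [theta beta]. *)
have app k : approximable (q ^+ k * c0) (fun z => expR (- v k z)).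
  elim: k => [|k IHk]; first by rewrite expr0 mul1r.
  have ck : 0 <= q ^+ k * c0 by rewrite mulr_ge0 ?exprn_ge0.
  have := approximable_expectation s20 hzeta tE (mulr_ge0 (ler0n R b) ck)
    (approximableX b ck IHk) (rec k).
  by congr approximable; rewrite exprS /q; ring.
move=> k; have rE : q ^+ k * b%:R * c0 = b%:R * (q ^+ k * c0) by ring.
have -> : 8 * q ^+ k * b%:R * c0 = 8 * (b%:R * (q ^+ k * c0)) by ring.
rewrite rE => r8; set r := b%:R * _ in r8 *.
have ck : 0 <= q ^+ k * c0 by rewrite mulr_ge0 ?exprn_ge0.
have r0 : 0 <= r by rewrite mulr_ge0.
have r08 : 0 <= r <= 1 / 8 by rewrite r0.
have r3 : r <= 1 / 3 by lra.
apply: ge_ereal_sup => _ [z _ [z' _ <-]].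
have [h1 h2] := smoothing_compare s20 hzeta tE r0 (approximableX b ck (app k)) (rec k) z' z r3.
rewrite !powE in h1 h2.
rewrite lee_fin ler_norml lerNl opprB; apply/andP; split; exact: ln_ratio_le.
Qed.
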